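(* Let $p$ be an odd prime, $k\ge1$, $q=p^k$ and $L=\mathbb F_{q^2}$. For the presemifield $C(p,2k,k,l,R)$, the associated semifield has left nucleus and right nucleus $\mathbb N_l=\mathbb N_r=\mathbb F_q$ and middle nucleus $\mathbb N_m=L=\mathbb F_{q^2}$ (where $L$ is identified with $L\times\{0\}$).
   Context: A finite presemifield $(F,+,* )$ is a finite abelian group $(F,+)$ with a multiplication satisfying both distributive laws and such that $x*y=0$ implies $x=0$ or $y=0$; a semifield is a presemifield with identity. For an integer $j\ge0$, $L^j=\{x^j:x\in L\}$. $C(p,2k,k,l,R)$ is defined for $l,R\in L^*$ with $-l\notin L^{q-1}$ and $R\notin L^{q+1}$: it is $F=L^2$ with multiplication $$(a,b)*(c,d)=\big(ac^{q}+Rbd^{q}+l(a^{q}c+Rb^{q}d),\ ad+bc\big).$$ Associated semifield: put $e=(1,0)$, define $\beta,\gamma\colon F\to F$ by $e*\beta(x)=x$ and $\gamma(x)*e=e*x$, and set $x\circ y=\beta(\gamma(x)*y)$. Then $(F,+,\circ)$ is a semifield isotopic to $(F,+,* )$ with identity $e$ (isotopic semifields have isomorphic nuclei). The set $L\times\{0\}\subset F$ is identified with $L$. Nuclei of a semifield $(F,+,\circ)$: $\mathbb N_l=\{u:(u\circ x)\circ y=u\circ(x\circ y)\ \forall x,y\}$, $\mathbb N_m=\{u:(x\circ u)\circ y=x\circ(u\circ y)\ \forall x,y\}$, $\mathbb N_r=\{u:(x\circ y)\circ u=x\circ(y\circ u)\ \forall x,y\}$. *)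

(* Defs.v *)
From HB Require Import structures.
From mathcomp Require Import all_boot all_order all_algebra all_field ring.

Set Implicit Arguments.
Unset Strict Implicit.
Unset Printing Implicit Defensive.

Import GRing.Theory.

Local Open Scope ring_scope.

Record presemifield := Presemifield {
  ps_sort :> finZmodType;
  ps_mul : ps_sort -> ps_sort -> ps_sort;
  ps_mulDl : left_distributive ps_mul +%R;
  ps_mulDr : right_distributive ps_mul +%R;
  ps_integral : forall x y, ps_mul x y = 0 -> x = 0 \/ y = 0
}.

Record semifield := Semifield {
  sf_presemifield :> presemifield;
  sf_one : sf_presemifield;
  sf_mul1x : left_id sf_one (@ps_mul sf_presemifield);
  sf_mulx1 : right_id sf_one (@ps_mul sf_presemifield)
}.

Definition left_nucleus (S : semifield) : {set S} :=
  [set u | [forall x : S, forall y : S,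
    ps_mul (ps_mul u x) y == ps_mul u (ps_mul x y)]].

Definition middle_nucleus (S : semifield) : {set S} :=
  [set u | [forall x : S, forall y : S,
    ps_mul (ps_mul x u) y == ps_mul x (ps_mul u y)]].

Definition right_nucleus (S : semifield) : {set S} :=
  [set u | [forall x : S, forall y : S,
    ps_mul (ps_mul x y) u == ps_mul x (ps_mul y u)]].

Lemma ps_mulBl (P : presemifield) (x y z : P) :
  ps_mul (x - y) z = ps_mul x z - ps_mul y z.
Proof. by apply: (addIr (ps_mul y z)); rewrite -ps_mulDl !subrK. Qed.

Lemma ps_mulBr (P : presemifield) (x y z : P) :
  ps_mul x (y - z) = ps_mul x y - ps_mul x z.
Proof. by apply: (addIr (ps_mul x z)); rewrite -ps_mulDr !subrK. Qed.

Lemma ps_mul_injl (P : presemifield) (e : P) (e_neq0 : e != 0) :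
  injective (ps_mul e).
Proof.
move=> x y /eqP; rewrite -subr_eq0 -ps_mulBr => /eqP/ps_integral.
by case=> /eqP; [rewrite (negPf e_neq0) | rewrite subr_eq0 => /eqP].
Qed.

Lemma ps_mul_injr (P : presemifield) (e : P) (e_neq0 : e != 0) :
  injective (fun x => ps_mul x e).
Proof.
move=> x y /eqP; rewrite -subr_eq0 -ps_mulBl => /eqP/ps_integral.
by case=> /eqP; [rewrite subr_eq0 => /eqP | rewrite (negPf e_neq0)].
Qed.

(* beta and gamma are the unique maps satisfying assoc_betaE and assoc_gammaE. *)
Definition assoc_beta (P : presemifield) (e : P) (e_neq0 : e != 0) (x : P) : P :=
  invF (ps_mul_injl e_neq0) x.

Definition assoc_gamma (P : presemifield) (e : P) (e_neq0 : e != 0) (x : P) : P :=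
  invF (ps_mul_injr e_neq0) (ps_mul e x).

Lemma assoc_betaE (P : presemifield) (e : P) (e_neq0 : e != 0) (x : P) :
  ps_mul e (assoc_beta e_neq0 x) = x.
Proof. exact: f_invF. Qed.

Lemma assoc_gammaE (P : presemifield) (e : P) (e_neq0 : e != 0) (x : P) :
  ps_mul (assoc_gamma e_neq0 x) e = ps_mul e x.
Proof. exact: (f_invF (ps_mul_injr e_neq0)). Qed.

Definition assoc_mul (P : presemifield) (e : P) (e_neq0 : e != 0) (x y : P) : P :=
  assoc_beta e_neq0 (ps_mul (assoc_gamma e_neq0 x) y).

Lemma assoc_mulDl (P : presemifield) (e : P) (e_neq0 : e != 0) :
  left_distributive (assoc_mul e_neq0) +%R.
Proof.
move=> x y z; apply: (ps_mul_injl e_neq0).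
rewrite ps_mulDr !assoc_betaE -ps_mulDl; congr (ps_mul _ z).
by apply: (ps_mul_injr e_neq0); rewrite ps_mulDl !assoc_gammaE ps_mulDr.
Qed.

Lemma assoc_mulDr (P : presemifield) (e : P) (e_neq0 : e != 0) :
  right_distributive (assoc_mul e_neq0) +%R.
Proof.
move=> x y z; apply: (ps_mul_injl e_neq0).
by rewrite ps_mulDr !assoc_betaE -ps_mulDr.
Qed.

Lemma ps_mulx0 (P : presemifield) (x : P) : ps_mul x 0 = 0.
Proof. by rewrite -[in LHS](subrr 0) ps_mulBr subrr. Qed.

Lemma ps_mul0x (P : presemifield) (x : P) : ps_mul 0 x = 0.
Proof. by rewrite -[in LHS](subrr 0) ps_mulBl subrr. Qed.

Lemma assoc_integral (P : presemifield) (e : P) (e_neq0 : e != 0) (x y : P) :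
  assoc_mul e_neq0 x y = 0 -> x = 0 \/ y = 0.
Proof.
move/(congr1 (ps_mul e)); rewrite assoc_betaE ps_mulx0 => /ps_integral.
case=> [gx0|->]; [left | by right].
apply: (ps_mul_injl e_neq0).
by rewrite ps_mulx0 -(assoc_gammaE e_neq0) gx0 ps_mul0x.
Qed.

Definition assoc_presemifield (P : presemifield) (e : P) (e_neq0 : e != 0) :
    presemifield :=
  Presemifield (assoc_mulDl e_neq0) (assoc_mulDr e_neq0)
               (@assoc_integral P e e_neq0).

Lemma assoc_mul1x (P : presemifield) (e : P) (e_neq0 : e != 0) :
  left_id (e : assoc_presemifield e_neq0) (assoc_mul e_neq0).
Proof.
move=> x; apply: (ps_mul_injl e_neq0); rewrite assoc_betaE.
by congr (ps_mul _ x); apply: (ps_mul_injr e_neq0); rewrite assoc_gammaE.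
Qed.

Lemma assoc_mulx1 (P : presemifield) (e : P) (e_neq0 : e != 0) :
  right_id (e : assoc_presemifield e_neq0) (assoc_mul e_neq0).
Proof.
by move=> x; apply: (ps_mul_injl e_neq0); rewrite assoc_betaE assoc_gammaE.
Qed.

Definition assoc_semifield (P : presemifield) (e : P) (e_neq0 : e != 0) :
    semifield :=
  @Semifield (assoc_presemifield e_neq0) e (assoc_mul1x e_neq0)
             (assoc_mulx1 e_neq0).

(* Includes 0 as soon as j > 0, exactly like L^j = {x^j : x in L}. *)
Definition powers (L : finFieldType) (j : nat) : {set L} :=
  [set x ^+ j | x : L].

HB.instance Definition _ (U V : finZmodType) := GRing.Zmodule.on (U * V)%type.

(* The multiplication of C(p, 2k, k, l, R), with q = p ^ k. *)
Definition C_mul (L : finFieldType) (q : nat) (l R : L) (x y : L * L) : L * L :=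
  let: (a, b) := x in
  let: (c, d) := y in
  (a * c ^+ q + R * b * d ^+ q + l * (a ^+ q * c + R * b ^+ q * d),
   a * d + b * c).

Lemma exprDq (p k : nat) (L : finFieldType) (pr_p : prime p)
    (cardL : #|L| = ((p ^ k) ^ 2)%N) (x y : L) :
  (x + y) ^+ (p ^ k) = x ^+ (p ^ k) + y ^+ (p ^ k).
Proof.
rewrite -expnM in cardL; apply: exprDn_pchar.
by rewrite pnatX pnatE // (card_finPcharP cardL pr_p).
Qed.

Lemma C_mulDl (p k : nat) (L : finFieldType) (pr_p : prime p)
    (cardL : #|L| = ((p ^ k) ^ 2)%N) (l R : L) :
  left_distributive (C_mul (p ^ k) l R) +%R.
Proof.
have := exprDq pr_p cardL; move: (p ^ k)%N => q D [a b] [a' b'] [c d].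
by congr pair; rewrite /= ?D; ring.
Qed.

Lemma C_mulDr (p k : nat) (L : finFieldType) (pr_p : prime p)
    (cardL : #|L| = ((p ^ k) ^ 2)%N) (l R : L) :
  right_distributive (C_mul (p ^ k) l R) +%R.
Proof.
have := exprDq pr_p cardL; move: (p ^ k)%N => q D [a b] [c d] [c' d'].
by congr pair; rewrite /= ?D; ring.
Qed.

Lemma C_aux (L : finFieldType) (q : nat) (q_gt0 : (0 < q)%N) (l : L)
    (l_pow : - l \notin powers L (q - 1)) (b d : L) :
  b * d ^+ q + l * (b ^+ q * d) = 0 -> b = 0 \/ d = 0.
Proof.
have [-> | b0] := eqVneq b 0; first by left.
have [-> | d0] := eqVneq d 0; first by right.
move=> bd0; case/imsetP: l_pow; exists (d / b) => //.
apply: (mulIf (mulf_neq0 (expf_neq0 q b0) d0)).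
rewrite mulNr -[LHS]add0r -bd0 addrK.
rewrite -{1 3}(subnK q_gt0) addn1 !exprS expr_div_n.
have := expf_neq0 (q - 1) b0.
by move: (_ ^+ _) (_ ^+ _) => u v v0; field; rewrite v0.
Qed.

Lemma C_integral (p k : nat) (L : finFieldType) (pr_p : prime p)
    (cardL : #|L| = ((p ^ k) ^ 2)%N) (l R : L)
    (l_pow : - l \notin powers L (p ^ k - 1))
    (R_pow : R \notin powers L (p ^ k + 1)) (x y : L * L) :
  C_mul (p ^ k) l R x y = 0 -> x = 0 \/ y = 0.
Proof.
have q_gt0 : (0 < p ^ k)%N by rewrite expn_gt0 prime_gt0.
have q_neq0 : (p ^ k)%N != 0 by rewrite -lt0n.
case: x y => [a b] [c d] [].
have [-> | b0] := eqVneq b 0.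
  rewrite mul0r addr0 mulr0 !mul0r !expr0n (negPf q_neq0) mulr0 !mul0r !addr0.
  case/(C_aux q_gt0 l_pow) => [-> | ->]; first by left.
  move=> /eqP; rewrite mulf_eq0 => /orP[] /eqP ->; [by left | by right].
have [-> _ | d0] := eqVneq d 0.
  by rewrite mulr0 add0r => /eqP; rewrite mulf_eq0 (negPf b0) => /eqP ->; right.
move=> E1 E2; have [t a_t] : exists t, a = t * b by exists (a / b); rewrite divfK.
have c_t : c = (-1) * (t * d).
  apply: (mulfI b0); move/eqP: E2; rewrite addrC addr_eq0 => /eqP ->.
  by rewrite a_t; ring.
have Nq : (-1 : L) ^+ (p ^ k) = -1.
  rewrite exprNn_pchar ?expr1n //.
  by rewrite pnatX pnatE // (@card_finPcharP _ p (k * 2)%N) ?expnM.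
have: (R - t ^+ (p ^ k + 1)) * (b * d ^+ (p ^ k) + l * (b ^+ (p ^ k) * d)) = 0.
  move: E1; rewrite c_t a_t !exprMn Nq => <-; rewrite addn1 exprS.
  by move: (p ^ k)%N => q; ring.
move/eqP; rewrite mulf_eq0 subr_eq0 => /orP[/eqP Rt | /eqP].
  by case/imsetP: R_pow; exists t.
case/(C_aux q_gt0 l_pow) => /eqP; first by rewrite (negPf b0).
by rewrite (negPf d0).
Qed.

Definition C_presemifield (p k : nat) (L : finFieldType) (pr_p : prime p)
    (cardL : #|L| = ((p ^ k) ^ 2)%N) (l R : L)
    (l_pow : - l \notin powers L (p ^ k - 1))
    (R_pow : R \notin powers L (p ^ k + 1)) : presemifield :=
  @Presemifield (L * L)%type (C_mul (p ^ k) l R)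
    (C_mulDl pr_p cardL l R) (C_mulDr pr_p cardL l R)
    (C_integral pr_p cardL l_pow R_pow).

Lemma C_one_neq0 (L : finFieldType) : (1, 0) != 0 :> L * L.
Proof. by rewrite xpair_eqE oner_eq0. Qed.

Definition C_semifield (p k : nat) (L : finFieldType) (pr_p : prime p)
    (cardL : #|L| = ((p ^ k) ^ 2)%N) (l R : L)
    (l_pow : - l \notin powers L (p ^ k - 1))
    (R_pow : R \notin powers L (p ^ k + 1)) : semifield :=
  @assoc_semifield (C_presemifield pr_p cardL l_pow R_pow) (1, 0) (C_one_neq0 L).

(* A subset A of L viewed inside L * L through L = L x {0}. *)
Definition embed (L : finFieldType) (A : {set L}) : {set L * L} :=
  [set (a, 0) | a in A].

(* F_q inside L = F_(q^2): the set is a subfield (subFq_divring_closed) with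
   exactly q elements (card_subFq), hence the unique one. *)
Definition subFq (L : finFieldType) (q : nat) : {set L} :=
  [set a | a ^+ q == a].

Lemma subFq_divring_closed (p k : nat) (L : finFieldType) (pr_p : prime p)
    (cardL : #|L| = ((p ^ k) ^ 2)%N) :
  divring_closed (subFq L (p ^ k)).
Proof.
split=> [|x y|x y]; rewrite !inE ?expr1n // => /eqP ex /eqP ey.
  rewrite (exprDq pr_p cardL) exprNn_pchar ?ex ?ey //.
  by rewrite pnatX pnatE // (@card_finPcharP _ p (k * 2)%N) ?expnM.
by rewrite expr_div_n ex ey.
Qed.

Lemma card_subFq (p k : nat) (L : finFieldType) (pr_p : prime p)
    (cardL : #|L| = ((p ^ k) ^ 2)%N) :
  #|subFq L (p ^ k)| = (p ^ k)%N.
Proof.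
have chL : p \in [pchar {poly L}].
  by rewrite (rmorph_pchar (@polyC L)) // (@card_finPcharP _ p (k * 2)%N) ?expnM.
have chq : [pchar {poly L}].-nat (p ^ k)%N by rewrite pnatX pnatE // chL.
have q_gt1 : (1 < p ^ k)%N.
  by rewrite -(ltn_exp2r _ _ (isT : 0 < 2)%N) -cardL exp1n finNzRing_gt1.
move: (p ^ k)%N cardL chq q_gt1 => q cardL chq q_gt1.
have szq : size ('X^q - 'X : {poly L}) = q.+1.
  by rewrite size_polyDl size_polyXn // size_polyN size_polyX ltnS.
have dvdq : ('X^q - 'X : {poly L}) %| \prod_x ('X - x%:P).
  rewrite -finField_genPoly cardL.
  have -> : 'X^(q ^ 2) - 'X = ('X^q - 'X) ^+ q + ('X^q - 'X) :> {poly L}.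
    by rewrite exprDn_pchar // exprNn_pchar // -exprM addrA subrK.
  by rewrite dvdp_addr ?dvdpp // dvdp_exp // ltnW.
have [m Dm] := dvdp_prod_XsubC dvdq.
have szm : size (mask m (index_enum L)) = q.
  by apply: succn_inj; rewrite -szq (eqp_size Dm) size_prod_XsubC.
rewrite -[RHS]szm -(card_uniqP (mask_uniq (index_enum_uniq L) m)); apply: eq_card => x.
rewrite inE -[RHS]root_prod_XsubC -(eqp_root Dm) rootE !hornerE.
by rewrite -subr_eq0.
Qed.

(* L x {0} is a copy of the field L in the associated semifield. *)
Lemma embed_mul (p k : nat) (L : finFieldType) (pr_p : prime p)
    (cardL : #|L| = ((p ^ k) ^ 2)%N) (l R : L)
    (l_pow : - l \notin powers L (p ^ k - 1))
    (R_pow : R \notin powers L (p ^ k + 1)) (a c : L) :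
  @ps_mul (C_semifield pr_p cardL l_pow R_pow) (a, 0) (c, 0) = (a * c, 0).
Proof.
have q0 : (p ^ k)%N != 0 by rewrite -lt0n expn_gt0 prime_gt0.
have aqq : (a ^+ (p ^ k)) ^+ (p ^ k) = a by rewrite -exprM mulnn -cardL expf_card.
set P := C_presemifield pr_p cardL l_pow R_pow.
apply: (@ps_mul_injl P (1, 0) (C_one_neq0 L)); rewrite assoc_betaE.
have -> : assoc_gamma (C_one_neq0 L : ((1, 0) : P) != 0) (a, 0) = (a ^+ (p ^ k), 0).
  apply: (@ps_mul_injr P (1, 0) (C_one_neq0 L)); rewrite assoc_gammaE.
  rewrite /= !expr0n (negPf q0) aqq expr1n.
  by congr pair; move: (p ^ k)%N => q; ring.
rewrite /= !expr0n (negPf q0) aqq expr1n exprMn.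
by congr pair; move: (p ^ k)%N => q; ring.
Qed.

(* Main.v *)
Require Import Defs.
From HB Require Import structures.
From mathcomp Require Import all_boot all_order all_algebra all_field.
From mathcomp Require Import cyclic ring.

Set Implicit Arguments.
Unset Strict Implicit.
Unset Printing Implicit Defensive.

Import GRing.Theory.
Local Open Scope ring_scope.

(** Write [x^] for the conjugate [x ^+ q] of [x] in [L] over [F_q].  The map
    [beta] inverts [x |-> x^ + l x], which can be done explicitly because
    [l l^ != 1]; this turns the associated semifield into
      [(a, b) o (c, d) = (a c + A b^ d + B b d^, a^ d + b c)]
    with constants [A] and [B], where [B = l^ (R^ - R) / (1 - l l^)]
    (lemma [C_semifield_mulE]).  The two hypotheses on [l] and [R] are exactly
    what makes the denominator and [R^ - R] nonzero: in the cyclic group of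
    units of [L], an element killed by [q + 1] is a [(q - 1)]-st power and vice
    versa, so [l l^ = 1] would make [- l] a [(q - 1)]-st power and [R^ = R]
    would make [R] a [(q + 1)]-st power (lemma [expr_eq1_powers]).

    With this formula the nuclei are read off.  Let [(s, t)] be in one of them.
    Associating it with one element of [L x 0] and one of [0 x L] gives
    [B t (r - r^) = 0], or the same with [t^] for [t], where [r] is any element
    that conjugation moves, so [t = 0].  The elements [(s, 0)] are all in the
    middle nucleus: [s] passes from [b] to [c] in [b c], while [b^ d] and [b d^]
    see [s^] on both sides and [s] on both sides.  In the left and right nuclei,
    [s] has to multiply [b^ d] and [b d^] alike although it acts on one of them
    through its conjugate, which forces [s^ = s]. *)

(** * Powers in a finite field *)

(** Writing [y] as a power [g ^+ i] of a primitive root, [y ^+ m = 1] means that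
    [m * j] divides [i * m], hence that [j] divides [i]. *)
Lemma expr_eq1_powers (L : finFieldType) (m j : nat) (y : L) :
  #|L|.-1 = (m * j)%N -> y != 0 -> y ^+ m = 1 -> y \in powers L j.
Proof.
move=> cardU y0 ym1.
have n_gt0 : (0 < #|L|.-1)%N by rewrite -subn1 subn_gt0 finNzRing_gt1.
have unitX (x : L) : x != 0 -> x ^+ #|L|.-1 = 1.
  move=> x0; apply: (mulfI x0); rewrite -exprS prednK ?mulr1 ?expf_card //.
  exact: ltnW (finNzRing_gt1 L).
have /hasP[g _ prim_g] : has (#|L|.-1).-primitive_root (enum (predC1 (0 : L))).
  apply: has_prim_root => //; first 2 last.
  - by rewrite -cardE cardC1.
  - by apply/allP => x; rewrite mem_enum => x0; apply/unity_rootP/unitX.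
  by rewrite enum_uniq.
have [[i /= _] yE] := prim_rootP prim_g (unitX _ y0).
move: ym1; rewrite yE -exprM => /eqP; rewrite -(prim_order_dvd prim_g) cardU.
have m_gt0 : (0 < m)%N by move: n_gt0; rewrite cardU muln_gt0 => /andP[].
rewrite mulnC dvdn_pmul2r // => /dvdnP[h ->].
by rewrite exprM; apply: imset_f.
Qed.

(** * Nuclei of a twisted multiplication on pairs *)

Definition twisted_mul (L : fieldType) (conj : L -> L) (A B : L)
    (x y : L * L) : L * L :=
  (x.1 * y.1 + A * conj x.2 * y.2 + B * x.2 * conj y.2,
   conj x.1 * y.2 + x.2 * y.1).

Lemma nonfixed_factor_eq0 (L : fieldType) (conj : L -> L) (B t r : L) :
  B != 0 -> conj r != r -> B * t * (r - conj r) = 0 -> t = 0.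
Proof.
move=> B0 r_nonfixed /eqP; rewrite !mulf_eq0 (negPf B0) subr_eq0 [r == _]eq_sym.
by rewrite (negPf r_nonfixed) orbF => /eqP.
Qed.

(** The triple [(u, (0, 1), (r, 0))] kills [t]: scaling by [r] comes out plain on
    one side and conjugated in the [B] term on the other.  After that
    [(u, (0, 1), (0, 1))] compares [B s^] with [s B]. *)
Lemma twisted_left_assocP (L : fieldType) (conj : {rmorphism L -> L})
    (A B r : L) (u : L * L) :
  involutive conj -> B != 0 -> conj r != r ->
  (forall x y, twisted_mul conj A B (twisted_mul conj A B u x) y =
               twisted_mul conj A B u (twisted_mul conj A B x y)) <->
  u.2 = 0 /\ conj u.1 = u.1.
Proof.
case: u => s t conjK B0 r_nonfixed; split=> [assoc | [/= -> sE] [a b] [c d]].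
  have t0 : t = 0.
    apply: (nonfixed_factor_eq0 B0 r_nonfixed).
    have /(congr1 fst)/eqP := assoc (0, 1) (r, 0).
    rewrite -subr_eq0 => /eqP <- /=.
    by rewrite !(rmorph0, rmorph1, rmorphD, rmorphM); ring.
  move: assoc; rewrite t0 => assoc; split=> //=.
  have /(congr1 fst)/eqP := assoc (0, 1) (0, 1).
  rewrite /= !(rmorph0, rmorph1, rmorphD, rmorphM, conjK) -subr_eq0 => /eqP E.
  by apply: (mulfI B0); apply/eqP; rewrite -subr_eq0 -E; apply/eqP; ring.
by congr pair; rewrite /= !(rmorph0, rmorphD, rmorphM, conjK) ?sE; ring.
Qed.

(** Here [((r, 0), (0, 1), u)] kills [t^]: the second coordinate of
    [(r, 0) o (0, 1)] is [r^], whereas [r] itself multiplies [(0, 1) o u]. *)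
Lemma twisted_right_assocP (L : fieldType) (conj : {rmorphism L -> L})
    (A B r : L) (u : L * L) :
  involutive conj -> B != 0 -> conj r != r ->
  (forall x y, twisted_mul conj A B (twisted_mul conj A B x y) u =
               twisted_mul conj A B x (twisted_mul conj A B y u)) <->
  u.2 = 0 /\ conj u.1 = u.1.
Proof.
case: u => s t conjK B0 r_nonfixed; split=> [assoc | [/= -> sE] [a b] [c d]].
  have t0 : t = 0.
    apply/eqP; rewrite -(fmorph_eq0 conj); apply/eqP.
    apply: (nonfixed_factor_eq0 B0 r_nonfixed).
    have /esym/(congr1 fst)/eqP := assoc (r, 0) (0, 1).
    rewrite -subr_eq0 => /eqP <- /=.
    by rewrite !(rmorph0, rmorph1, rmorphD, rmorphM, conjK); ring.
  move: assoc; rewrite t0 => assoc; split=> //=.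
  have /esym/(congr1 fst)/eqP := assoc (0, 1) (0, 1).
  rewrite /= !(rmorph0, rmorph1, rmorphD, rmorphM, conjK) -subr_eq0 => /eqP E.
  by apply: (mulfI B0); apply/eqP; rewrite -subr_eq0 -E; apply/eqP; ring.
by congr pair; rewrite /= !(rmorph0, rmorphD, rmorphM, conjK) ?sE; ring.
Qed.

(** Here [((r, 0), u, (0, 1))] kills [t], for the same reason as on the right. *)
Lemma twisted_middle_assocP (L : fieldType) (conj : {rmorphism L -> L})
    (A B r : L) (u : L * L) :
  involutive conj -> B != 0 -> conj r != r ->
  (forall x y, twisted_mul conj A B (twisted_mul conj A B x u) y =
               twisted_mul conj A B x (twisted_mul conj A B u y)) <->
  u.2 = 0.
Proof.
case: u => s t conjK B0 r_nonfixed; split=> [assoc | /= -> [a b] [c d]].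
  apply: (nonfixed_factor_eq0 B0 r_nonfixed).
  have /esym/(congr1 fst)/eqP := assoc (r, 0) (0, 1).
  rewrite -subr_eq0 => /eqP <- /=.
  by rewrite !(rmorph0, rmorph1, rmorphD, rmorphM, conjK); ring.
by congr pair; rewrite /= !(rmorph0, rmorphD, rmorphM, conjK); ring.
Qed.

(** * The associated semifield as a twisted multiplication *)

(** The automorphism [x |-> x ^+ q]; the hypotheses on [p] and [L] are arguments
    because its additivity depends on them. *)
Definition conjq (p k : nat) (L : finFieldType) (pr_p : prime p)
  (cardL : #|L| = ((p ^ k) ^ 2)%N) (x : L) : L := x ^+ (p ^ k).

Section Conjugation.

Context (p k : nat) (L : finFieldType) (pr_p : prime p)
  (cardL : #|L| = ((p ^ k) ^ 2)%N).

Local Notation conj := (conjq pr_p cardL).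

Lemma conjq_zmod_morphism : zmod_morphism conj.
Proof.
move=> x y; apply: (addIr (conj y)).
by rewrite /conjq -(exprDq pr_p cardL) !subrK.
Qed.

Lemma conjq_monoid_morphism : monoid_morphism conj.
Proof. by split=> [|x y]; rewrite /conjq ?expr1n ?exprMn. Qed.

HB.instance Definition _ :=
  GRing.isZmodMorphism.Build L L conj conjq_zmod_morphism.
HB.instance Definition _ :=
  GRing.isMonoidMorphism.Build L L conj conjq_monoid_morphism.

Lemma conjqK : involutive conj.
Proof. by move=> x; rewrite /conjq -exprM mulnn -cardL expf_card. Qed.

(** If [l l^ = 1] then [- l] is killed by [q + 1], hence is a [(q - 1)]-st
    power because [#|L| - 1 = (q + 1) (q - 1)]. *)
Lemma norm_neq1_of_non_power (l : L) :
  l != 0 -> - l \notin powers L (p ^ k - 1) -> 1 - l * conj l != 0.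
Proof.
move=> l0; apply: contra => /eqP N1.
apply: (@expr_eq1_powers L (p ^ k + 1)).
- by rewrite cardL -subn1 -[X in (_ - X)%N](exp1n 2) subn_sqr mulnC.
- by rewrite oppr_eq0.
rewrite addn1 exprS -/(conjq pr_p cardL (- l)) rmorphN mulrNN.
by apply/eqP; rewrite eq_sym -subr_eq0 N1.
Qed.

(** The same argument with [q + 1] and [q - 1] exchanged. *)
Lemma conjq_neq_of_non_power (R : L) :
  R != 0 -> R \notin powers L (p ^ k + 1) -> conj R != R.
Proof.
move=> R0; apply: contra => /eqP RE.
apply: (@expr_eq1_powers L (p ^ k - 1)) => //.
  by rewrite cardL -subn1 -[X in (_ - X)%N](exp1n 2) subn_sqr.
apply: (mulfI R0); rewrite -exprS mulr1 -[RHS]RE subn1 prednK //.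
by rewrite expn_gt0 prime_gt0.
Qed.

(** Here [gamma (a, b) = (a^, b)].  The coefficients come from solving
    [z^ + l z = w] together with its conjugate [z + l^ z^ = w^], which gives
    [(1 - l l^) z = w^ - l^ w]. *)
Lemma C_semifield_mulE (l R : L)
    (l_pow : - l \notin powers L (p ^ k - 1))
    (R_pow : R \notin powers L (p ^ k + 1)) (x y : L * L) :
  1 - l * conj l != 0 ->
  @ps_mul (C_semifield pr_p cardL l_pow R_pow) x y =
  twisted_mul conj ((conj R - l * conj l * R) / (1 - l * conj l))
    (conj l * (conj R - R) / (1 - l * conj l)) x y.
Proof.
case: x y => [a b] [c d] N1_neq0.
set P := C_presemifield pr_p cardL l_pow R_pow.
have PE (x y : L * L) : @ps_mul P x y =
    (x.1 * conj y.1 + R * x.2 * conj y.2 +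
     l * (conj x.1 * y.1 + R * conj x.2 * y.2), x.1 * y.2 + x.2 * y.1).
  by case: x y => [? ?] [? ?].
apply: (@ps_mul_injl P (1, 0) (C_one_neq0 L)); rewrite assoc_betaE.
have -> : assoc_gamma (C_one_neq0 L : ((1, 0) : P) != 0) (a, b) = (conj a, b).
  apply: (@ps_mul_injr P (1, 0) (C_one_neq0 L)); rewrite assoc_gammaE !PE.
  rewrite /= !(rmorph0, rmorph1) conjqK.
  by congr pair; ring.
rewrite !PE /twisted_mul /= !(rmorph0, rmorph1).
rewrite !(rmorphD, rmorphB, rmorphN, rmorphM, fmorphV, rmorph1) /= !conjqK.
move: N1_neq0; move: (conj a) (conj b) (conj c) (conj d) (conj l) (conj R).
move=> a' b' c' d' l' R' N1_neq0.
congr pair; last by ring.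
by field.
Qed.

End Conjugation.

Theorem proposition8p1 (p k : nat) (L : finFieldType) (l R : L)
    (pr_p : prime p) (odd_p : odd p) (k_ge1 : (1 <= k)%N)
    (cardL : #|L| = ((p ^ k) ^ 2)%N)
    (l_neq0 : l != 0) (R_neq0 : R != 0)
    (l_pow : - l \notin powers L (p ^ k - 1))
    (R_pow : R \notin powers L (p ^ k + 1)) :
  let S := C_semifield pr_p cardL l_pow R_pow in
  [/\ left_nucleus S = embed (subFq L (p ^ k)),
      right_nucleus S = embed (subFq L (p ^ k)) &
      middle_nucleus S = embed [set: L] ].
Proof.
move=> S; set conj := conjq pr_p cardL.
have N1_neq0 := norm_neq1_of_non_power pr_p cardL l_neq0 l_pow.
have R_nonfixed := conjq_neq_of_non_power pr_p cardL R_neq0 R_pow.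
pose A := (conj R - l * conj l * R) / (1 - l * conj l).
pose B := conj l * (conj R - R) / (1 - l * conj l).
have B_neq0 : B != 0.
  apply: mulf_neq0; last by rewrite invr_eq0.
  by apply: mulf_neq0; rewrite ?subr_eq0 // (fmorph_eq0 (conjq pr_p cardL)).
have mulE x y : @ps_mul S x y = twisted_mul conj A B x y :=
  C_semifield_mulE l_pow R_pow x y N1_neq0.
have conjK := conjqK pr_p cardL.
have embedP (X : {set L}) (u : L * L) :
    (u \in embed X) = (u.2 == 0) && (u.1 \in X).
  case: u => s t; apply/imsetP/andP => [[a aX [-> ->]] | [/eqP/= -> sX]].
    by rewrite eqxx.
  by exists s.
split; apply/setP => u; rewrite inE embedP ?inE ?andbT.
- have [nuc sub] := twisted_left_assocP A u conjK B_neq0 R_nonfixed.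
  apply/idP/andP => [/'forall_'forall_eqP assoc | [/eqP u2 /eqP u1]].
    have [x y|u2 u1] := nuc; first by rewrite -!mulE.
    by split; apply/eqP.
  by apply/'forall_'forall_eqP => x y; rewrite !mulE sub.
- have [nuc sub] := twisted_right_assocP A u conjK B_neq0 R_nonfixed.
  apply/idP/andP => [/'forall_'forall_eqP assoc | [/eqP u2 /eqP u1]].
    have [x y|u2 u1] := nuc; first by rewrite -!mulE.
    by split; apply/eqP.
  by apply/'forall_'forall_eqP => x y; rewrite !mulE sub.
- have [nuc sub] := twisted_middle_assocP A u conjK B_neq0 R_nonfixed.
  apply/idP/eqP => [/'forall_'forall_eqP assoc | u2].
    by apply: nuc => x y; rewrite -!mulE.
  by apply/'forall_'forall_eqP => x y; rewrite !mulE sub.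
Qed.
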